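(* Let $\mathcal{L} = (G, a_0, I, \theta)$ be a ladget with $I=(i_1,\dots,i_n)$. Then $\deg(i_j)\ge 2$ for every $j\in\{1,\dots,n\}$.
   Context: A ladget is a tuple $\mathcal{L}=(G,a_0,I,\theta)$ where $G=(V,E)$ is a finite simple graph, $a_0\in V$ is the anchor vertex, $I=(i_1,\dots,i_n)$ with $n\ge 1$ is an ordered tuple of distinct input vertices, and $\theta\in V$ is the output vertex, with $a_0$, the inputs and $\theta$ pairwise distinct. A valid 3-coloring is a proper coloring $c:V\to\{0,1,2\}$ (adjacent vertices get distinct colors) with $c(a_0)=0$. A vertex has Boolean value $0$ if its color is $0$ and Boolean value $1$ if its color is in $\{1,2\}$. $\mathcal{L}$ is required to implement a Boolean function $\varphi_{\mathcal{L}}:\{0,1\}^n\to\{0,1\}$ that depends on every input (for each $j$ there are two input vectors differing only in coordinate $j$ on which $\varphi_{\mathcal{L}}$ differs), meaning: (Universality) every assignment of colors from $\{0,1,2\}$ to the input vertices extends to a valid 3-coloring; (Consistency) in every valid 3-coloring, the Boolean value of $\theta$ equals $\varphi_{\mathcal{L}}$ applied to the Boolean values of $i_1,\dots,i_n$. *)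

(* Defs.v *)
From mathcomp Require Import all_boot.

Set Implicit Arguments.
Unset Strict Implicit.
Unset Printing Implicit Defensive.

Record sgraph := SGraph {
  vertex :> finType;
  adj : rel vertex;
  adj_sym : symmetric adj;
  adj_irrefl : irreflexive adj }.

Definition deg (G : sgraph) (v : G) : nat := #|[set w | adj v w]|.

Definition color := 'I_3.

Definition proper_coloring (G : sgraph) (c : G -> color) : Prop :=
  forall v w : G, adj v w -> c v != c w.

Definition valid_3coloring (G : sgraph) (a0 : G) (c : G -> color) : Prop :=
  proper_coloring c /\ c a0 = ord0.

Definition bool_value (k : color) : bool := k != ord0.

Definition depends_on n (phi : {ffun 'I_n -> bool} -> bool) (j : 'I_n) : Prop :=
  exists x y : {ffun 'I_n -> bool},
    (forall k, k != j -> x k = y k) /\ phi x != phi y.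

Definition universality (G : sgraph) (a0 : G) n (I : n.-tuple G) : Prop :=
  forall s : 'I_n -> color,
    exists c : G -> color,
      valid_3coloring a0 c /\ forall j, c (tnth I j) = s j.

Definition consistency (G : sgraph) (a0 : G) n (I : n.-tuple G) (theta : G)
    (phi : {ffun 'I_n -> bool} -> bool) : Prop :=
  forall c : G -> color, valid_3coloring a0 c ->
    bool_value (c theta) = phi [ffun j => bool_value (c (tnth I j))].

Definition implements (G : sgraph) (a0 : G) n (I : n.-tuple G) (theta : G)
    (phi : {ffun 'I_n -> bool} -> bool) : Prop :=
  [/\ forall j, depends_on phi j,
      universality a0 I
    & consistency a0 I theta phi].

(* The implemented function is only asserted to exist: universality together
   with consistency determines it uniquely, so it is not part of the data. *)
Record ladget := Ladget {
  graph : sgraph;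
  anchor : graph;
  arity : nat;
  inputs : arity.-tuple graph;
  output : graph;
  arity_gt0 : 0 < arity;
  ladget_uniq : uniq [:: anchor, output & inputs];
  ladget_implements : exists phi, implements anchor inputs output phi }.

(* Main.v *)
Require Import Defs.
From mathcomp Require Import all_boot.

(** Suppose the input vertex v has degree at most 1, and colour v with 0. Its
    neighbour, if any, has a nonzero colour, so one of 1, 2 is free for v.
    Recolouring v flips the Boolean value of that input alone and leaves the
    output untouched, so the function does not depend on it. *)

Definition recolor {G : sgraph} (c : G -> color) (v : G) (k : color) : G -> color :=
  fun u => if u == v then k else c u.

Lemma recolor_proper {G : sgraph} (c : G -> color) (v : G) (k : color) :
  proper_coloring c -> (forall w, adj v w -> c w != k) ->
  proper_coloring (recolor c v k).
Proof.
move=> cP kP u w; rewrite /recolor.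
case: (u =P v) => [->|_]; case: (w =P v) => [->|_] uw; last exact: cP.
- by rewrite (@adj_irrefl G) in uw.
- by rewrite eq_sym kP.
- by rewrite kP // adj_sym.
Qed.

(** A single neighbour blocks at most one of the two nonzero colours: take 2 if it has colour 1, and
    1 otherwise. *)
Lemma free_nonzero_color {G : sgraph} (c : G -> color) (v : G) :
  deg v <= 1 ->
  exists2 k : color, bool_value k & forall w, adj v w -> c w != k.
Proof.
move=> /card_le1_eqP nbr_eq; pose k1 : color := inord 1; pose k2 : color := inord 2.
case: (boolP [exists w, adj v w && (c w == k1)]) => [|/existsPn k1P].
  case/existsP=> w /andP[vw /eqP cw].
  exists k2; first by rewrite /bool_value -val_eqE /= inordK.
  move=> u vu; rewrite (nbr_eq w u) ?inE // cw.
  by rewrite -val_eqE /= !inordK.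
exists k1; first by rewrite /bool_value -val_eqE /= inordK.
by move=> w vw; have := k1P w; rewrite vw.
Qed.

(** Two witnesses agreeing at [j] too would be equal, so they differ there; swapping them if needed
    fixes the direction of the flip to be from 0 to 1. *)
Lemma depends_on_flip {n} {phi : {ffun 'I_n -> bool} -> bool} {j : 'I_n} :
  depends_on phi j ->
  exists x y : {ffun 'I_n -> bool},
    [/\ forall k, k != j -> x k = y k, x j = false, y j = true & phi x != phi y].
Proof.
case=> x [y [xy phi_xy]].
have xyj : x j != y j.
  apply: contraNneq phi_xy => xyj; suff -> : x = y by [].
  by apply/ffunP => k; have [->|/xy] := eqVneq k j.
case xj: (x j) xyj; case yj: (y j) => // _; last by exists x, y.
by exists y, x; split=> // [k /xy|]; rewrite 1?eq_sym.
Qed.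

Theorem mainTheorem8 (L : ladget) (j : 'I_(arity L)) :
  2 <= deg (tnth (inputs L) j).
Proof.
case: L j => G a0 n I theta _ I_uniq [phi [dep univ cons]] /= j.
rewrite ltnNge; apply/negP => deg_le1.
have [x [y [xy xj yj /negP]]] := depends_on_flip (dep j); apply.
set v := tnth I j in deg_le1 *.
have vI : v \in I := mem_tnth j I.
move: I_uniq; rewrite /= inE negb_or => /and3P[/andP[_ a0I] thetaI I_uniq].
have tv : theta != v by apply: contraNneq thetaI => ->.
have av : a0 != v by apply: contraNneq a0I => ->.
(* Colour 1 is an arbitrary representative of Boolean value 1; since [x j] is false, [v] gets colour
   0. *)
have [c [[c_prop ca0] cI]] := univ (fun k => if x k then inord 1 else ord0).
have [k k_nz kP] := free_nonzero_color c v deg_le1.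
have recolor_valid : valid_3coloring a0 (recolor c v k).
  by split; [exact: recolor_proper | rewrite /recolor (negPf av)].
have /cons : valid_3coloring a0 c by [].
(* Both colourings give [theta] the same colour, so [phi] agrees on their input vectors. *)
have := cons _ recolor_valid; rewrite {1}/recolor (negPf tv) => -> eq_phi.
apply/eqP; rewrite (_ : x = [ffun i => bool_value (c (tnth I i))]); last first.
  apply/ffunP => i; rewrite ffunE cI /bool_value.
  by case: (x i); rewrite ?eqxx // -val_eqE /= inordK.
(* The recoloured inputs read as [y]: true at [j], and as in [x] elsewhere because the inputs are
   distinct. *)
rewrite -eq_phi; congr phi; apply/ffunP => i; rewrite ffunE /recolor.
have [->|ij] := eqVneq i j; first by rewrite eqxx yj.
have -> : (tnth I i == v) = false.
  by apply: contraNF ij => /eqP/(tuple_uniqP _ I_uniq) ->.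
rewrite cI /bool_value -xy //.
by case: (x i); rewrite ?eqxx // -val_eqE /= inordK.
Qed.
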